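(* Let $k\ge 1$, let $\pi_\beta$ be a strictly positive, continuously differentiable density on $\mathbb{R}^k$ that is sub-exponentially light, and suppose there exist $\alpha>k$ and $R<\infty$ such that $$\bigl|\nabla\log\pi_\beta(\beta)\bigr|\le\frac{\alpha}{|\beta|},\qquad |\beta|>R.$$ Let $b>0$, define $f:[0,\infty)\to[0,\infty)$ by $f(x)=e^{bx}-\frac{e}{3}$ for $x>\frac1b$ and $f(x)=x^3\frac{b^3e}{6}+x\frac{be}{2}$ for $x\le\frac1b$, and define $h:\mathbb{R}^k\to\mathbb{R}^k$ by $h(\gamma)=f(|\gamma|)\,\gamma/|\gamma|$ for $\gamma\ne0$ and $h(0)=0$. Let $$\pi_\gamma(\gamma)=\pi_\beta\bigl(h(\gamma)\bigr)\,\bigl|\det\nabla h(\gamma)\bigr|,\qquad \gamma\in\mathbb{R}^k.$$ Then $|\nabla\log\pi_\gamma(\gamma)|$ is bounded as $|\gamma|$ goes to infinity, i.e. there are $M,r<\infty$ with $|\nabla\log\pi_\gamma(\gamma)|\le M$ whenever $|\gamma|>r$.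
   Context: $|\cdot|$ denotes the Euclidean norm on $\mathbb{R}^k$, and $\cdot$ between vectors the inner product; $e$ is the base of the natural logarithm. Densities are with respect to Lebesgue measure. $\nabla h(\gamma)$ is the Jacobian matrix of $h$. A strictly positive continuously differentiable density $\pi$ on $\mathbb{R}^k$ is sub-exponentially light if $$\limsup_{|x|\to\infty}\frac{x}{|x|}\cdot\nabla\log\pi(x)=0.$$ *)

(* Defs.v *)
From HB Require Import structures.
From mathcomp Require Export all_boot all_order all_algebra.
From mathcomp Require Export all_classical all_reals all_analysis.
Export Order.TTheory GRing.Theory Num.Theory.
Export numFieldNormedType.Exports.

Set Implicit Arguments.
Unset Strict Implicit.
Unset Printing Implicit Defensive.

Local Open Scope classical_set_scope.
Local Open Scope ring_scope.

Section euclidean.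
Context {R : realType} {k : nat}.
Implicit Types x y : 'rV[R]_k.

Definition dotp x y : R := \sum_(i < k) x 0 i * y 0 i.

(* The library norm `|x| on row vectors is the sup norm, hence this one. *)
Definition enorm x : R := Num.sqrt (dotp x x).

Definition gradient (p : 'rV[R]_k -> R) x : 'rV[R]_k :=
  \row_(i < k) 'D_(delta_mx 0 i) p x.

(* Meaningful only at points where p is positive and ln \o p differentiable:
   'D_v and ln are total functions in the library. *)
Definition grad_log (p : 'rV[R]_k -> R) : 'rV[R]_k -> 'rV[R]_k :=
  gradient (fun x => ln (p x)).

Definition continuously_differentiable (p : 'rV[R]_k -> R) :=
  (forall x, differentiable p x) /\ continuous (gradient p).

Definition enorm_pinfty : set_system 'rV[R]_k :=
  filter_from [set: R] (fun r => [set x | r < enorm x]).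

Definition subexponentially_light (p : 'rV[R]_k -> R) :=
  limf_esup (fun x => (dotp ((enorm x)^-1 *: x) (grad_log p x))%:E)
    enorm_pinfty = 0%E.

End euclidean.

(* Lebesgue measure on R^k, as the k-fold product of the Lebesgue measure on R,
   carried by the library's product sigma-algebra on k-tuples. *)
Section lebesgue_tuple.
Context {R : realType}.
Local Notation mR := (measurableTypeR R).
Local Open Scope ereal_scope.

Definition tuple_cons n (z : mR * n.-tuple mR) : n.+1.-tuple mR :=
  [the n.+1.-tuple mR of z.1 :: z.2].

Lemma measurable_tuple_cons n : measurable_fun setT (@tuple_cons n).
Proof. exact: measurable_cons. Qed.

Section step.
Variables (n : nat) (mu : {sigma_finite_measure set (n.-tuple mR) -> \bar R}).

Definition lebesgue_cons : set (n.+1.-tuple mR) -> \bar R :=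
  pushforward (@lebesgue_measure R \x mu) (@tuple_cons n).

Let lebesgue_cons0 : lebesgue_cons set0 = 0.
Proof. by rewrite /lebesgue_cons /pushforward preimage_set0 measure0. Qed.

Let lebesgue_cons_ge0 A : 0 <= lebesgue_cons A.
Proof. by rewrite /lebesgue_cons /pushforward; exact: measure_ge0. Qed.

Let preim_measurable (A : set (n.+1.-tuple mR)) :
  measurable A -> measurable (@tuple_cons n @^-1` A).
Proof.
by move=> mA; rewrite -[X in measurable X]setTI; exact: measurable_tuple_cons.
Qed.

Let lebesgue_cons_sigma_additive : semi_sigma_additive lebesgue_cons.
Proof.
move=> F mF tF mUF; rewrite /lebesgue_cons /pushforward preimage_bigcup.
apply: measure_semi_sigma_additive.
- by move=> i; exact: preim_measurable.
- apply/trivIsetP => /= i j _ _ ij; rewrite -preimage_setI.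
  by move/trivIsetP : tF => /(_ _ _ _ _ ij) ->//; rewrite preimage_set0.
- by rewrite -preimage_bigcup; exact: preim_measurable.
Qed.

HB.instance Definition _ := isMeasure.Build _ _ _ lebesgue_cons
  lebesgue_cons0 lebesgue_cons_ge0 lebesgue_cons_sigma_additive.

Lemma lebesgue_consE (A : set mR) (B : set (n.-tuple mR)) :
  measurable A -> measurable B ->
  lebesgue_cons [set t : n.+1.-tuple mR | A (thead t) /\ B [tuple of behead t]] =
  @lebesgue_measure R A * mu B.
Proof.
move=> mA mB; rewrite -product_measure1E// /lebesgue_cons /pushforward.
congr (_ _); apply/seteqP; split => -[x t] /=.
  by rewrite theadE (_ : [tuple of _] = t)//; exact: val_inj.
by rewrite theadE (_ : [tuple of _] = t)//; exact: val_inj.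
Qed.

Let lebesgue_cons_sigma_finite : sigma_finite setT lebesgue_cons.
Proof.
have /sigma_finiteP[F [TF ndF Foo]] := sigma_finiteT (@lebesgue_measure R).
have /sigma_finiteP[G [TG ndG Goo]] := sigma_finiteT mu.
exists (fun i => [set t : n.+1.-tuple mR |
  F i (thead t) /\ G i [tuple of behead t]]).
  rewrite predeqE => t; split => // _.
  have [i _ Fi] : (\bigcup_i F i) (thead t) by rewrite -TF.
  have [j _ Gj] : (\bigcup_i G i) [tuple of behead t] by rewrite -TG.
  exists (maxn i j) => //; split.
    by move: Fi; exact/subsetPset/ndF/leq_maxl.
  by move: Gj; exact/subsetPset/ndG/leq_maxr.
move=> i; have [? ?] := Foo i; have [? ?] := Goo i; split; last first.
  by rewrite lebesgue_consE// lte_mul_pinfty// ge0_fin_numE.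
rewrite (_ : [set _ | _] = [set t : n.+1.-tuple mR | F i (thead t)] `&`
  [set t : n.+1.-tuple mR | G i [tuple of behead t]])//; apply: measurableI.
  rewrite -[X in measurable X]setTI.
  exact: (measurable_tnth (@ord0 n)).
rewrite -[X in measurable X]setTI; exact: measurable_behead.
Qed.

HB.instance Definition _ := Measure_isSigmaFinite.Build _ _ _ lebesgue_cons
  lebesgue_cons_sigma_finite.

End step.

Fixpoint lebesgue_tuple k : {sigma_finite_measure set (k.-tuple mR) -> \bar R} :=
  match k with
  | 0%N => dirac (nil_tuple mR)
  | n.+1 => lebesgue_cons (lebesgue_tuple n)
  end.

Lemma lebesgue_tuple_box k (A : 'I_k -> set mR) :
  (forall i, measurable (A i)) ->
  lebesgue_tuple k [set t | forall i, A i (tnth t i)] =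
  \prod_(i < k) @lebesgue_measure R (A i).
Proof.
elim: k A => [|k IH] A mA.
  rewrite big_ord0 /= diracE.
  by rewrite mem_set//= => i; have := ltn_ord i.
have mB : measurable [set t : k.-tuple mR | forall i, A (lift ord0 i) (tnth t i)].
  rewrite (_ : [set _ | _] = \bigcap_(i in [set: 'I_k])
    [set t : k.-tuple mR | A (lift ord0 i) (tnth t i)]); last first.
    by apply/seteqP; split => t /= At i; [move=> _|]; exact: At.
  apply: fin_bigcap_measurable => // i _; rewrite -[X in measurable X]setTI.
  exact: (measurable_tnth i).
rewrite big_ord_recl -IH// -lebesgue_consE//=; congr (lebesgue_cons _ _).
apply/seteqP; split => t /=.
  move=> At; split; first exact: (At ord0).
  by move=> i; have := At (lift ord0 i); rewrite {1}(tuple_eta t) tnthS.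
move=> [A0 At] i; have [->//|i0] := eqVneq i ord0.
case: (unliftP ord0 i) i0 => [j ->|->]; last by rewrite eqxx.
by move=> _; rewrite (tuple_eta t) tnthS.
Qed.

End lebesgue_tuple.

Definition is_density {R : realType} {k : nat} (p : 'rV[R]_k -> R) :=
  let q (t : k.-tuple (measurableTypeR R)) : R := p (\row_(i < k) tnth t i) in
  [/\ forall x, 0 <= p x,
      measurable_fun setT q &
      (\int[lebesgue_tuple k]_t (q t)%:E = 1)%E].

Definition radial_profile {R : realType} (b x : R) : R :=
  if b^-1 < x then expR (b * x) - expR 1 / 3
  else x ^+ 3 * (b ^+ 3 * expR 1 / 6) + x * (b * expR 1 / 2).

Definition radial_map {R : realType} {k : nat} (f : R -> R) (g : 'rV[R]_k) :
  'rV[R]_k :=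
  if g == 0 then 0 else (f (enorm g) / enorm g) *: g.

(* The library Jacobian acts on row vectors, so it is the transpose of the
   matrix of partial derivatives (dh_i/dx_j)_ij; the determinant is the same. *)
Definition pullback_density {R : realType} {k : nat}
    (p : 'rV[R]_k -> R) (h : 'rV[R]_k -> 'rV[R]_k) (g : 'rV[R]_k) : R :=
  p (h g) * `|\det (jacobian h g)|.

(* Main.v *)
From HB Require Import structures.
Require Import Defs.
From mathcomp Require Import ring lra.

(** Away from the origin the radial map h(y) = (f(r)/r) y, with r = |y|, has
    the symmetric Jacobian a I + c y y^T, where a = f(r)/r and
    c = (f'(r) - a)/r^2: it multiplies directions orthogonal to y by a and the
    direction of y by f'(r).  Its determinant is therefore a^(k-1) f'(r)
    ([det_jacobian_radial_map]), and
      ln pi_gamma(y) = ln pi_beta(h y) + J(|y|),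
      J(r) = (k-1) (ln f(r) - ln r) + ln f'(r).
    Differentiating ([is_diff_ln_pullback_radial_map]), the gradient is the
    Jacobian applied to the gradient G of ln pi_beta at h y, plus J'(r) y/r, so
    that its norm is at most (2 a + f'(r)) |G| + |J'(r)|
    ([enorm_radial_gradient_le]).

    The tail hypothesis gives |G| <= alpha/|h y| = alpha/f(r) as soon as f(r)
    is large, and the first term becomes alpha (2/r + f'(r)/f(r)).  Everything
    is thus controlled by 1/r, f'/f and f''/f', and these are bounded because f
    grows like exp(b r): for r > 1/b one has exp 1 <= exp(b r), hence
    f(r) >= (2/3) exp(b r), f'/f <= 3b/2, f''/f' = b and 1/r <= b. *)

Set Implicit Arguments.
Unset Strict Implicit.
Unset Printing Implicit Defensive.

Local Open Scope classical_set_scope.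
Local Open Scope ring_scope.

(** * Euclidean inner product and norm *)

Section dotp.
Context {R : realType} {k : nat}.
Implicit Types x y z : 'rV[R]_k.

Lemma dotpC x y : dotp x y = dotp y x.
Proof. by apply: eq_bigr => i _; rewrite mulrC. Qed.

Lemma dotpDl x y z : dotp (x + y) z = dotp x z + dotp y z.
Proof. by rewrite -big_split; apply: eq_bigr => i _; rewrite mxE mulrDl. Qed.

Lemma dotpZl a x y : dotp (a *: x) y = a * dotp x y.
Proof. by rewrite mulr_sumr; apply: eq_bigr => i _; rewrite mxE mulrA. Qed.

Lemma dotpDr x y z : dotp x (y + z) = dotp x y + dotp x z.
Proof. by rewrite dotpC dotpDl !(dotpC x). Qed.

Lemma dotpZr a x y : dotp x (a *: y) = a * dotp x y.
Proof. by rewrite dotpC dotpZl dotpC. Qed.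

Lemma dotp_ge0 x : 0 <= dotp x x.
Proof. by apply: sumr_ge0 => i _; rewrite -expr2 sqr_ge0. Qed.

Lemma dotp_eq0 x : (dotp x x == 0) = (x == 0).
Proof.
apply/idP/eqP => [|->]; last by rewrite /dotp big1// => i _; rewrite mxE mul0r.
rewrite psumr_eq0 => [/allP x0|i _]; last by rewrite -expr2 sqr_ge0.
apply/rowP => i; rewrite mxE; apply/eqP.
by have := x0 i (mem_index_enum i); rewrite -expr2 sqrf_eq0.
Qed.

Lemma dotp_delta x i : dotp x (delta_mx 0 i) = x 0 i.
Proof.
rewrite /dotp (bigD1 i)//= mxE !eqxx mulr1 big1 ?addr0// => j ji.
by rewrite mxE eqxx (negPf ji) mulr0.
Qed.

Lemma enorm_ge0 x : 0 <= enorm x.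
Proof. exact: sqrtr_ge0. Qed.

Lemma sqr_enorm x : enorm x ^+ 2 = dotp x x.
Proof. by rewrite sqr_sqrtr ?dotp_ge0. Qed.

Lemma enorm_gt0 x : (0 < enorm x) = (x != 0).
Proof. by rewrite sqrtr_gt0 lt_def dotp_ge0 andbT dotp_eq0. Qed.

Lemma enormZ a x : enorm (a *: x) = `|a| * enorm x.
Proof. by rewrite /enorm dotpZl dotpZr mulrA -expr2 sqrtrM ?sqr_ge0// sqrtr_sqr. Qed.

(** Positivity of the square of |y|^2 x - (x.y) y, which is |y|^2 times the
    defect |x|^2 |y|^2 - (x.y)^2. *)
Lemma cauchy_schwarz_dotp x y : `|dotp x y| <= enorm x * enorm y.
Proof.
rewrite -ler_sqr ?nnegrE ?mulr_ge0 ?enorm_ge0 ?normr_ge0//.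
rewrite real_normK ?num_real// exprMn !sqr_enorm.
have [->|y0] := eqVneq y 0.
  by rewrite -[X in dotp x X](scale0r 0) dotpZr mul0r expr0n mulr_ge0 ?dotp_ge0.
have C0 : 0 < dotp y y by rewrite lt_def dotp_eq0 y0 dotp_ge0.
have := dotp_ge0 (dotp y y *: x + (- dotp x y) *: y).
rewrite !dotpDl !dotpDr !dotpZl !dotpZr (dotpC y x) => h.
rewrite -subr_ge0 -(pmulr_rge0 _ C0).
by apply: le_trans h _; rewrite le_eqVlt; apply/orP; left; apply/eqP; ring.
Qed.

Lemma enormD x y : enorm (x + y) <= enorm x + enorm y.
Proof.
rewrite -ler_sqr ?nnegrE ?addr_ge0 ?enorm_ge0// sqr_enorm !dotpDl !dotpDr.
rewrite (dotpC y x) -!sqr_enorm.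
have := le_trans (ler_norm _) (cauchy_schwarz_dotp x y); nra.
Qed.

End dotp.

(** * Determinant of a rank-one perturbation of a scalar matrix *)

(** The block matrix with rows (1, -v) and (u, a I) can be triangularised by
    eliminating u from below or from the left; comparing the two determinants
    gives the identity. *)
Lemma det_scalar_rank1 (F : fieldType) k (a : F) (u : 'cV[F]_k) (v : 'rV[F]_k) :
  (0 < k)%N -> a != 0 ->
  \det (a%:M + u *m v) = a ^+ k.-1 * (a + (v *m u) 0 0).
Proof.
case: k u v => // n u v _ a0.
pose M := block_mx (1%:M : 'M[F]_1) (- v) u (a%:M : 'M[F]_n.+1).
have ML : M = block_mx 1%:M 0 u 1%:M *m block_mx 1%:M (- v) 0 (a%:M + u *m v).
  rewrite mulmx_block !mul1mx !mulmx1 !mulmx0 ?mul0mx !addr0 /M.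
  by rewrite mulmxN addrC addrK.
have MR : M = block_mx (1%:M + a^-1 *: (v *m u)) (- v) 0 a%:M
    *m block_mx 1%:M 0 (a^-1 *: u) 1%:M.
  rewrite mulmx_block !mulmx1 ?mulmx0 ?mul0mx ?addr0 ?add0r /M.
  rewrite mul_scalar_mx scalerA divff// scale1r -scalemxAr mulNmx scalerN.
  by rewrite addrK.
have := congr1 determinant MR; rewrite {1}ML !det_mulmx !det_lblock !det_ublock.
rewrite !det1 !mul1r !mulr1 => ->; rewrite det_mx11 !mxE eqxx det_scalar exprS /=.
by field.
Qed.

(** * Rules for differentials *)

Section is_diff.
Context {R : numFieldType} {V W : normedModType R}.

(** Differentials are local.  This matters for the pulled back density, whose
    closed form holds only where the profile is positive and differentiable
    with positive derivative. *)
Lemma near_eq_is_diff (f g df : V -> W) x :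
  (\near x, f x = g x) -> is_diff x f df -> is_diff x g df.
Proof.
move=> fg [fx dfE].
have fgx : f x = g x := nbhs_singleton fg.
have gE : g \o shift x = cst (g x) + 'd f x +o_ 0 id.
  apply/eqaddoP => _ /posnumP[e].
  have := diff_locally fx => /eqaddoP /(_ e%:num (gt0 e)) fo.
  have fg0 : {near (0 : V), f \o shift x =1 g \o shift x}.
    by have := fg; rewrite (near_shift 0) subr0.
  near=> h.
  have <- : (f \o shift x - (cst (f x) + 'd f x)) h =
            (g \o shift x - (cst (g x) + 'd f x)) h.
    rewrite -fgx; congr (_ - _).
    by near: h.
  by near: h.
have dgE := diff_unique (diff_continuous fx) gE.
apply: DiffDef; last by rewrite dgE.
by apply/diff_locallyP; rewrite dgE; split => //; exact: diff_continuous.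
Unshelve. all: by end_near. Qed.

Lemma is_diff_sum n (f df : 'I_n -> V -> W) x :
  (forall i, is_diff x (f i) (df i)) ->
  is_diff x (\sum_(i < n) f i) (\sum_(i < n) df i).
Proof.
move=> fdf; apply: (big_ind2 (fun f df : V -> W => is_diff x f df)) => //.
  exact: is_diff_cst.
by move=> ? ? ? ? ? ?; exact: is_diffD.
Qed.

Lemma scaler_is_bilinear :
  bilinear_for
    (GRing.Scale.Law.clone _ _ *:%R _) (GRing.Scale.Law.clone _ _ *:%R _)
    (@GRing.scale R W).
Proof.
split=> [u|u] a x y /=; first by rewrite scalerDl scalerA.
by rewrite scalerDr !scalerA mulrC.
Qed.

HB.instance Definition _ := bilinear_isBilinear.Build R R W W _ _ (@GRing.scale R W)
  scaler_is_bilinear.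

Lemma is_diff_scalefun (k dk : V -> R) (f df : V -> W) x :
  is_diff x k dk -> is_diff x f df ->
  is_diff x (fun y => k y *: f y) (fun v => k x *: df v + dk v *: f x).
Proof.
move=> kx fx.
have sc : continuous (fun p : R * W => p.1 *: p.2).
  by move=> p; apply: cvgZ => //; [exact: cvg_fst|exact: cvg_snd].
have -> : (fun y => k y *: f y) = (fun p => p.1 *: p.2) \o (fun y => (k y, f y)) by [].
have dsc : is_diff (k x, f x) (fun p : R * W => p.1 *: p.2)
    (fun q => k x *: q.2 + q.1 *: f x).
  apply: DiffDef; first exact: (@differentiable_bilin _ _ _ _ (@GRing.scale R W)).
  exact: (@diff_bilin _ _ _ _ (@GRing.scale R W)).
exact: is_diff_comp.
Qed.
End is_diff.

Lemma is_diff_comp_derive (R : numFieldType) (V : normedModType R)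
    (q : R -> R) (dq : R) (f df : V -> R) x :
  is_derive (f x) 1 q dq -> is_diff x f df ->
  is_diff x (q \o f) (fun v => dq * df v).
Proof.
move=> qx fx.
have dqx : is_diff (f x) q ( *%R dq).
  case: qx => qd qE.
  apply: DiffDef; first exact/derivable1_diffP.
  rewrite deriv1E//; apply/funext => v.
  by rewrite derive1E qE /= mulrC.
exact: is_diff_comp.
Qed.

(** * Differential and Jacobian of radial maps *)

Section radial.
Context {R : realType} {k : nat}.
Implicit Types g v w y : 'rV[R]_k.

Lemma is_diff_sqr_dotp g :
  is_diff g (fun y => dotp y y) (fun v => 2 * dotp g v).
Proof.
have -> : (fun y => dotp y y) = \sum_(i < k) ((fun y => y 0 i) * (fun y => y 0 i)).
  by apply/funext => y; rewrite fct_sumE.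
have coord (i : 'I_k) : is_diff g (fun y => y 0 i : R) (fun v => v 0 i).
  have lin : linear (fun v : 'rV[R]_k => v 0 i : R) by move=> c u v; rewrite !mxE.
  pose L : {linear 'rV[R]_k -> R} :=
    HB.pack (fun v : 'rV[R]_k => v 0 i : R) (GRing.isLinear.Build _ _ _ _ _ lin).
  apply: DiffDef; first exact: differentiable_coord.
  by rewrite (@diff_lin _ _ _ L)//; exact: coord_continuous.
apply: is_diff_eq; first exact: is_diff_sum.
apply/funext => v; rewrite fct_sumE mulr_sumr; apply: eq_bigr => i _.
by rewrite !fctE /GRing.scale /=; ring.
Qed.

Lemma is_diff_enorm g : g != 0 ->
  is_diff g enorm (fun v => (enorm g)^-1 * dotp g v).
Proof.
rewrite -enorm_gt0 => g0.
have gg0 : 0 < dotp g g by rewrite -sqr_enorm exprn_gt0.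
apply: (is_diff_eq (is_diff_comp_derive (f := fun y => dotp y y)
  (is_derive1_sqrt gg0) (is_diff_sqr_dotp g))).
apply/funext => v; rewrite -/(enorm g).
by field; rewrite gt_eqF.
Qed.

Lemma near_enorm_gt r g : 0 <= r -> r < enorm g -> \forall y \near g, r < enorm y.
Proof.
move=> r0 rg; have g0 : g != 0 by rewrite -enorm_gt0 (le_lt_trans r0).
have [dg _] := is_diff_enorm g0.
exact: (cvgr_gt _ (differentiable_continuous dg)).
Qed.

(** Product rule for y |-> q(|y|) y with q(r) = f(r)/r, using
    q'(r) = (f'(r) - q(r))/r and d|y|(v) = (y.v)/|y|. *)
Lemma is_diff_radial_map (f : R -> R) (f' : R) g : g != 0 -> is_derive (enorm g) 1 f f' ->
  let a := f (enorm g) / enorm g in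
  is_diff g (radial_map f)
    (fun v => a *: v + ((f' - a) / enorm g ^+ 2 * dotp g v) *: g).
Proof.
move=> g0 ff' a.
have r0 : enorm g != 0 by rewrite gt_eqF// enorm_gt0.
(* At the origin the formula scales the zero vector, which gives 0 as well. *)
have -> : radial_map f = (fun y => (f (enorm y) / enorm y) *: y).
  by apply/funext => y; rewrite /radial_map; case: eqP => // ->; rewrite scaler0.
have qd : is_derive (enorm g) 1 (fun r => f r / r) ((f' - a) / enorm g).
  have dV : is_derive (enorm g) 1 (fun r : R => r^-1) (- (enorm g) ^- 2 *: 1).
    apply: DeriveDef; first exact: derivableV.
    by rewrite deriveV// derive_id.
  apply: (is_derive_eq (is_deriveM ff' dV)).
  rewrite /a /GRing.scale /=; by field.
apply: is_diff_eq.
  exact: (is_diff_scalefun (is_diff_comp_derive qd (is_diff_enorm g0)) (is_diff_id g)).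
apply/funext => v; rewrite !fctE /=; congr (_ + _ *: _); by field.
Qed.

Lemma diff_dotp_gradient (p : 'rV[R]_k -> R) g v :
  differentiable p g -> 'd p g v = dotp (gradient p g) v.
Proof.
move=> dp; rewrite {1}(row_sum_delta v) linear_sum; apply: eq_bigr => i _.
by rewrite linearZ /= mxE deriveE// mulrC.
Qed.

(** Recovers the gradient from any representation of the differential as an
    inner product. *)
Lemma is_diff_gradient (p : 'rV[R]_k -> R) g w :
  is_diff g p (dotp w) -> gradient p g = w.
Proof.
move=> [dp dpE]; apply/rowP => i.
by rewrite mxE deriveE// dpE dotp_delta.
Qed.

Lemma det_jacobian_radial_map (f : R -> R) (f' : R) g : (0 < k)%N -> g != 0 ->
  is_derive (enorm g) 1 f f' -> f (enorm g) != 0 ->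
  \det (jacobian (radial_map f) g) = (f (enorm g) / enorm g) ^+ k.-1 * f'.
Proof.
move=> k0 g0 ff' fr0; set a := _ / _.
have r0 : enorm g != 0 by rewrite gt_eqF// enorm_gt0.
have [dh dhE] := is_diff_radial_map g0 ff'; rewrite -/a in dhE.
have -> : jacobian (radial_map f) g =
    a%:M + g^T *m (((f' - a) / enorm g ^+ 2) *: g).
  apply/matrixP => i j; rewrite /jacobian !mxE dhE big_ord1 !mxE dotp_delta eqxx /=.
  rewrite eq_sym; case: eqP => _ /=; ring.
rewrite det_scalar_rank1// ?mulf_neq0 ?invr_neq0//.
rewrite -scalemxAl mxE.
have -> : (g *m g^T) 0 0 = enorm g ^+ 2.
  by rewrite sqr_enorm !mxE; apply: eq_bigr => i _; rewrite mxE.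
by congr (_ * _); field.
Qed.

End radial.

(** * Gradient of the log of a density pulled back by a radial map *)

Section log_pullback.
Context {R : realType} {k : nat}.
Implicit Types g v w y : 'rV[R]_k.

Lemma enorm_radial_map (f : R -> R) g : g != 0 -> 0 <= f (enorm g) ->
  enorm (radial_map f g) = f (enorm g).
Proof.
move=> g0 f0; have r0 : 0 < enorm g by rewrite enorm_gt0.
rewrite /radial_map (negPf g0) enormZ ger0_norm ?divr_ge0 ?enorm_ge0//.
by rewrite divfK// gt_eqF.
Qed.

(** The logarithm of the Jacobian determinant a^(k-1) f'(x), a = f(x)/x, of
    the radial map of profile f, as a function of the radius. *)
Definition log_jacobian (f f' : R -> R) (x : R) : R :=
  k.-1%:R * (ln (f x) - ln x) + ln (f' x).

Definition log_jacobian_deriv (f f' : R -> R) (f'' x : R) : R :=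
  k.-1%:R * (f' x / f x - x^-1) + f'' / f' x.

Lemma is_derive_log_jacobian (f f' : R -> R) (f'' x : R) : 0 < x ->
  0 < f x -> 0 < f' x -> is_derive x 1 f (f' x) -> is_derive x 1 f' f'' ->
  is_derive x 1 (log_jacobian f f') (log_jacobian_deriv f f' f'' x).
Proof.
move=> x0 fx0 f'x0 ff' ff''.
have lnd (q : R -> R) (q' : R) : 0 < q x -> is_derive x 1 q q' ->
    is_derive x 1 (fun t => ln (q t)) (q' / q x).
  move=> qx0 qq'.
  have := is_derive1_comp (is_derive1_ln qx0) qq'.
  by move/is_derive_eq; apply; rewrite mulrC.
have d1 := is_deriveB (lnd _ _ fx0 ff') (is_derive1_ln x0).
have d2 := is_deriveD (is_deriveZ k.-1%:R d1) (lnd _ _ f'x0 ff'').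
exact: d2.
Qed.

Lemma ln_pullback_radial_map (p : 'rV[R]_k -> R) (f f' : R -> R) g :
  (0 < k)%N -> g != 0 -> 0 < p (radial_map f g) ->
  is_derive (enorm g) 1 f (f' (enorm g)) -> 0 < f (enorm g) -> 0 < f' (enorm g) ->
  ln (pullback_density p (radial_map f) g) =
  ln (p (radial_map f g)) + log_jacobian f f' (enorm g).
Proof.
move=> k0 g0 p0 ff' f0 f'0; have r0 : 0 < enorm g by rewrite enorm_gt0.
rewrite /pullback_density (det_jacobian_radial_map k0 g0 ff') ?gt_eqF//.
have a0 : 0 < f (enorm g) / enorm g by rewrite divr_gt0.
rewrite gtr0_norm ?mulr_gt0 ?exprn_gt0// lnM ?posrE ?mulr_gt0 ?exprn_gt0//.
by rewrite lnM ?posrE ?exprn_gt0// lnXn// ln_div// -mulr_natl.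
Qed.

(** Since the differential of the radial map is a symmetric operator, its adjoint
    sends the gradient G of ln p to a G + ((f' - a)/r^2 (g.G)) g; the Jacobian
    factor depends only on the radius and contributes a multiple of g. *)
Lemma is_diff_ln_pullback_radial_map (p : 'rV[R]_k -> R) (f f' : R -> R) (f'' : R) g :
  (0 < k)%N -> g != 0 -> (forall y, 0 < p y) -> differentiable p (radial_map f g) ->
  (\forall x \near enorm g, [/\ is_derive (x : R) 1 f (f' x), 0 < f x & 0 < f' x]) ->
  is_derive (enorm g) 1 f' f'' ->
  let G := grad_log p (radial_map f g) in
  let a := f (enorm g) / enorm g in
  is_diff g (fun y => ln (pullback_density p (radial_map f) y))
    (dotp (a *: G + ((f' (enorm g) - a) / enorm g ^+ 2 * dotp g G
           + log_jacobian_deriv f f' f'' (enorm g) / enorm g) *: g)).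
Proof.
move=> k0 g0 p0 dp ff ff'' G a; have r0 : 0 < enorm g by rewrite enorm_gt0.
have [ff' f0 f'0] := nbhs_singleton ff.
have dh := is_diff_radial_map g0 ff'.
have de := is_diff_enorm g0.
apply: (@near_eq_is_diff _ _ _
    (fun y => ln (p (radial_map f y)) + log_jacobian f f' (enorm y))).
  have ce : {for g, continuous enorm} by case: de => ? _; exact: differentiable_continuous.
  have ffg := ce _ ff.
  have gg : \forall y \near g, 0 < enorm y := near_enorm_gt (lexx 0) r0.
  near=> y.
  have [fy1 fy2 fy3] : [/\ is_derive (enorm y) 1 f (f' (enorm y)), 0 < f (enorm y) &
    0 < f' (enorm y)] by near: y.
  have y0 : 0 < enorm y by near: y.
  by rewrite (@ln_pullback_radial_map p f f')// -enorm_gt0.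
have dlnp : is_diff (radial_map f g) (fun y => ln (p y)) (dotp G).
  have dq := (is_diff_comp_derive (is_derive1_ln (p0 _)) (differentiableP dp)).
  apply: DiffDef; first by case: dq.
  by apply/funext => v; rewrite diff_dotp_gradient//; case: dq.
have d1 := is_diff_comp dh dlnp.
have d2 := is_diff_comp_derive (is_derive_log_jacobian r0 f0 f'0 ff' ff'') de.
apply: (is_diff_eq (is_diffD d1 d2)).
apply/funext => v; rewrite !fctE /= !dotpDr !dotpDl !dotpZr !dotpZl (dotpC G g).
rewrite -/a; ring.
Unshelve. all: by end_near. Qed.

(** By Cauchy-Schwarz the component along g costs at most |f' - a| |G|, and
    |f' - a| <= f' + a. *)
Lemma enorm_radial_gradient_le (a f' L : R) g G :
  0 < a -> 0 < f' -> g != 0 ->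
  enorm (a *: G + ((f' - a) / enorm g ^+ 2 * dotp g G + L / enorm g) *: g) <=
  (2 * a + f') * enorm G + `|L|.
Proof.
move=> a0 f'0 g0; have r0 : 0 < enorm g by rewrite enorm_gt0.
have fa : `|f' - a| <= f' + a.
  by rewrite (le_trans (ler_normB _ _))// !gtr0_norm.
have -> : (2 * a + f') * enorm G + `|L| = a * enorm G + ((f' + a) * enorm G + `|L|).
  ring.
apply: le_trans (enormD _ _) _; rewrite enormZ gtr0_norm// lerD2l.
rewrite enormZ -[X in _ * X](gtr0_norm r0) -normrM mulrDl divfK ?gt_eqF//.
apply: le_trans (ler_normD _ _) _; rewrite lerD2r.
have -> : (f' - a) / enorm g ^+ 2 * dotp g G * enorm g =
  (f' - a) * (dotp g G / enorm g) by field; rewrite gt_eqF.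
rewrite normrM ler_pM// normf_div (gtr0_norm r0) ler_pdivrMr// mulrC.
exact: cauchy_schwarz_dotp.
Qed.

End log_pullback.

(** * The exponential profile and the bound *)

Section profile.
Context {R : realType}.
Variables (b : R) (b0 : 0 < b).

Lemma radial_profile_deriv (x : R) : b^-1 < x ->
  is_derive x 1 (radial_profile b) (b * expR (b * x)).
Proof.
move=> bx.
apply: (@near_eq_is_derive _ _ _ (fun y => expR (b * y) - expR 1 / 3)).
  near=> y; rewrite /radial_profile ifT//.
  by near: y; exact: lt_nbhsr.
have d1 : is_derive x 1 (fun y : R => b * y) b.
  by apply: (is_derive_eq (is_deriveZ b (is_derive_id x 1))); rewrite scaler1.
have d2 := is_derive1_comp (is_derive_expR (b * x)) d1.
apply: (is_derive_eq (is_deriveB d2 (is_derive_cst (expR 1 / 3) x 1))).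
by rewrite subr0 mulrC.
Unshelve. all: by end_near. Qed.

Lemma radial_profile_deriv2 (x : R) :
  is_derive x 1 (fun y => b * expR (b * y)) (b ^+ 2 * expR (b * x)).
Proof.
have d1 : is_derive x 1 (fun y : R => b * y) b.
  by apply: (is_derive_eq (is_deriveZ b (is_derive_id x 1))); rewrite scaler1.
have d2 := is_derive1_comp (is_derive_expR (b * x)) d1.
apply: (is_derive_eq (is_deriveZ b d2)).
by rewrite /GRing.scale /=; ring.
Qed.

(** Beyond 1/b the subtracted constant (exp 1)/3 is at most a third of
    exp(b x). *)
Lemma radial_profile_ge x : b^-1 < x -> 2 / 3 * expR (b * x) <= radial_profile b x.
Proof.
move=> bx; rewrite /radial_profile bx.
have : expR 1 <= expR (b * x).
  by rewrite ler_expR -(mulfV (lt0r_neq0 b0)) ler_pM2l// ltW.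
lra.
Qed.
End profile.

Theorem theorem5 (R : realType) (k : nat) (pi_beta : 'rV[R]_k -> R) (b : R)
  (hk : (1 <= k)%N)
  (pi_beta_density : is_density pi_beta)
  (pi_beta_gt0 : forall x, 0 < pi_beta x)
  (pi_beta_C1 : continuously_differentiable pi_beta)
  (pi_beta_light : subexponentially_light pi_beta)
  (pi_beta_tail : exists alpha r : R, k%:R < alpha /\
     forall x : 'rV[R]_k, r < enorm x ->
       enorm (grad_log pi_beta x) <= alpha / enorm x)
  (hb : 0 < b) :
  let h : 'rV[R]_k -> 'rV[R]_k := radial_map (radial_profile b) in
  let pi_gamma : 'rV[R]_k -> R := pullback_density pi_beta h in
  exists M r : R, forall g : 'rV[R]_k, r < enorm g ->
    differentiable (fun x => ln (pi_gamma x)) g /\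
    enorm (grad_log pi_gamma g) <= M.
Proof.
move=> h pi_gamma; have [alpha [R0 [kalpha tail]]] := pi_beta_tail.
have alpha0 : 0 < alpha by exact: le_lt_trans kalpha.
have bV0 : 0 < b^-1 by rewrite invr_gt0.
(* The bound adds alpha (2/r + f'/f), (k-1) (f'/f + 1/r) and f''/f' = b, with
   1/r <= b and f'/f <= 3b/2.  The second part of the radius makes
   (2/3) b r > |R0|, so that f(r) > R0. *)
exists (alpha * (2 * b + 3 / 2 * b) + (k.-1%:R * (3 / 2 * b + b) + b)),
  (b^-1 + 3 / 2 * `|R0| / b) => g rg.
have bg : b^-1 < enorm g.
  by apply: le_lt_trans rg; rewrite lerDl !mulr_ge0 ?invr_ge0 ?(ltW hb).
have r0 : 0 < enorm g by exact: lt_trans bg.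
have g0 : g != 0 by rewrite -enorm_gt0.
pose f := radial_profile b; pose f' (x : R) := b * expR (b * x).
have f_gt0 x : b^-1 < x -> 0 < f x.
  move=> /(radial_profile_ge hb); apply: lt_le_trans.
  by rewrite mulr_gt0 ?expR_gt0.
have f'_gt0 x : 0 < f' x by rewrite mulr_gt0 ?expR_gt0.
have ff' : \forall x \near enorm g, [/\ is_derive (x : R) 1 f (f' x), 0 < f x & 0 < f' x].
  near=> x; have bx : b^-1 < x by near: x; exact: lt_nbhsr.
  by split; [exact: radial_profile_deriv|exact: f_gt0|exact: f'_gt0].
have [dp _] := pi_beta_C1.
have D := is_diff_ln_pullback_radial_map hk g0 pi_beta_gt0 (dp _) ff'
  (radial_profile_deriv2 b (enorm g)).
split; first by case: D.
rewrite /grad_log (is_diff_gradient D).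
pose a := f (enorm g) / enorm g; have a0 : 0 < a by rewrite divr_gt0// f_gt0.
apply: le_trans (enorm_radial_gradient_le _ _ a0 (f'_gt0 _) g0) _.
have fg0 := f_gt0 _ bg.
have f'f : f' (enorm g) / f (enorm g) <= 3 / 2 * b.
  rewrite ler_pdivrMr//; have := radial_profile_ge hb bg.
  by rewrite -(ler_pM2l hb) /f /f'; lra.
have f'f0 : 0 < f' (enorm g) / f (enorm g) by rewrite divr_gt0.
have rVb : (enorm g)^-1 <= b by rewrite invf_ple ?posrE// ltW.
have rV0 : 0 < (enorm g)^-1 by rewrite invr_gt0.
apply: lerD.
  have R0f : R0 < f (enorm g).
    have : `|R0| < 2 / 3 * (b * enorm g).
      move: rg; rewrite -(ltr_pM2l hb) mulrDr mulrCA divff ?gt_eqF//; lra.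
    have := radial_profile_ge hb bg; have := expR_ge1Dx (b * enorm g).
    have := ler_norm R0; rewrite /f; lra.
  have hE : enorm (h g) = f (enorm g) by rewrite enorm_radial_map// ltW.
  have G : enorm (grad_log pi_beta (h g)) <= alpha / f (enorm g).
    by rewrite -hE tail// hE.
  apply: (@le_trans _ _ ((2 * (f (enorm g) / enorm g) + f' (enorm g)) *
    (alpha / f (enorm g)))).
    rewrite ler_wpM2l//; have := f'_gt0 (enorm g); move: a0; rewrite /a; lra.
  have -> : (2 * (f (enorm g) / enorm g) + f' (enorm g)) * (alpha / f (enorm g)) =
     alpha * (2 * (enorm g)^-1 + f' (enorm g) / f (enorm g)).
    by field; rewrite !gt_eqF.
  rewrite ler_pM2l//; lra.
have f''E : b ^+ 2 * expR (b * enorm g) / f' (enorm g) = b.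
  by rewrite /f'; field; rewrite !gt_eqF ?expR_gt0.
rewrite /log_jacobian_deriv f''E.
apply: le_trans (ler_normD _ _) _; rewrite (gtr0_norm hb) lerD2r.
rewrite normrM ger0_norm ?ler0n// ler_wpM2l ?ler0n//.
by apply: le_trans (ler_normB _ _) _; rewrite !gtr0_norm//; exact: lerD.
Unshelve. all: by end_near. Qed.
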